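(* Let $\mathbb{K}$ be a field, $n\in\{6,7,8\}$, and let $\theta$ be a non-trivial oppomorphism of the building $\mathsf{E}_n(\mathbb{K})$ which is a polar $\{1,2'\}$-kangaroo. (i) If $n=6$, then $\theta$ is either anisotropic or domestic. (ii) If $n\in\{7,8\}$, then $\theta$ is either anisotropic, or $\theta$ is domestic and fixes no chamber.
   Context: An oppomorphism is an automorphism mapping each vertex to a vertex of the opposite type (for $\mathsf{E}_7,\mathsf{E}_8$ this means type preserving; for $\mathsf{E}_6$ it means inducing the non-trivial diagram automorphism). An automorphism is anisotropic if every chamber is mapped to an opposite chamber, and domestic if no chamber is mapped to an opposite chamber. The long root subgroup geometry of $\mathsf{E}_n(\mathbb{K})$ is $\mathsf{E}_{6,2}(\mathbb{K})$, $\mathsf{E}_{7,1}(\mathbb{K})$, $\mathsf{E}_{8,8}(\mathbb{K})$ respectively (points = vertices of type $2,1,8$, Bourbaki labelling). For two of its points the mutual position is $0$ if equal, $1$ if distinct and collinear, $2$ if non-collinear but in a common symplecton (convex subspace isomorphic to a polar space), $2'$ if non-collinear with a unique common neighbour, $3$ if opposite. $\theta$ is a polar $\{1,2'\}$-kangaroo if no point $x$ has $x^\theta$ at mutual position $1$ or $2'$ from $x$. *)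

(* Defs.v *)
(* Buildings of type E_n as W-metric spaces (Abramenko-Brown,
   Def. 5.1), with the Weyl group W(E_n) realised concretely as the matrix group
   generated by the simple reflections acting on the root lattice Z^n
   (basis of simple roots, Bourbaki labelling; index k : 'I_n is label k+1). *)
From HB Require Import structures.
From mathcomp Require Import all_boot all_order all_algebra.
Set Implicit Arguments. Unset Strict Implicit. Unset Printing Implicit Defensive.
Import GRing.Theory.
Local Open Scope ring_scope.

(* Dynkin diagram of E_n, Bourbaki labels shifted by -1:
   1-3-4-5-6-7-8 with 2 attached to 4. *)
Definition En_edge (a b : nat) : bool :=
  [|| (a == 0%N) && (b == 2%N), (a == 2%N) && (b == 3%N),
      (a == 3%N) && (b == 4%N), (a == 4%N) && (b == 5%N),
      (a == 5%N) && (b == 6%N), (a == 6%N) && (b == 7%N)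
    | (a == 1%N) && (b == 3%N)].

Definition cartan (n : nat) : 'M[int]_n :=
  \matrix_(i, j) (if i == j then 2 else if En_edge i j || En_edge j i then -1 else 0).

(* simple reflection s_i : v |-> v - <a_i, v> e_i *)
Definition gen (n : nat) (i : 'I_n) : 'M[int]_n :=
  1%:M - delta_mx i i *m cartan n.

Definition prodgen (n : nat) (s : seq 'I_n) : 'M[int]_n :=
  foldr (fun i m => gen i *m m) 1%:M s.

Definition in_W (n : nat) (w : 'M[int]_n) : Prop := exists s, w = prodgen s.

Definition len_is (n : nat) (w : 'M[int]_n) (k : nat) : Prop :=
  (exists s, size s = k /\ w = prodgen s) /\ (forall s, w = prodgen s -> (k <= size s)%N).

Definition is_thick_building (n : nat) (C : Type) (delta : C -> C -> 'M[int]_n) : Prop :=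
  [/\ (forall c d, in_W (delta c d)),
      (forall c d, delta c d = 1%:M <-> c = d),
      (forall c d c' (i : 'I_n), delta c' c = gen i ->
          (delta c' d = gen i *m delta c d \/ delta c' d = delta c d) /\
          ((forall k, len_is (delta c d) k -> len_is (gen i *m delta c d) k.+1) ->
             delta c' d = gen i *m delta c d)),
      (forall c d (i : 'I_n), exists c', delta c' c = gen i /\ delta c' d = gen i *m delta c d)
    & (forall c (i : 'I_n), exists d1 d2, d1 <> d2 /\ delta c d1 = gen i /\ delta c d2 = gen i)].

Definition opposite (n : nat) (C : Type) (delta : C -> C -> 'M[int]_n) (c d : C) : Prop :=
  exists k, len_is (delta c d) k /\ (forall (w : 'M[int]_n) k', in_W w -> len_is w k' -> (k' <= k)%N).

(* nontrivial diagram automorphism of E_6 (1<->6, 3<->5), identity otherwise *)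
Definition sigma_nat (n k : nat) : nat :=
  if n == 6%N then
    (if k == 0%N then 5%N else if k == 5%N then 0%N
     else if k == 2%N then 4%N else if k == 4%N then 2%N else k)
  else k.

Definition Psigma (n : nat) : 'M[int]_n :=
  \matrix_(i, j) (if nat_of_ord i == sigma_nat n j then 1 else 0).

Definition opp_twist (n : nat) (w : 'M[int]_n) : 'M[int]_n :=
  Psigma n *m w *m Psigma n.

Definition oppomorphism (n : nat) (C : Type) (delta : C -> C -> 'M[int]_n) (theta : C -> C) : Prop :=
  bijective theta /\ forall c d, delta (theta c) (theta d) = opp_twist (delta c d).

Definition anisotropic (n : nat) (C : Type) (delta : C -> C -> 'M[int]_n) (theta : C -> C) : Prop :=
  forall c, opposite delta c (theta c).

Definition domestic (n : nat) (C : Type) (delta : C -> C -> 'M[int]_n) (theta : C -> C) : Prop :=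
  forall c, ~ opposite delta c (theta c).

(* point type of the long root subgroup geometry: labels 2, 1, 8 *)
Definition point_type (n : nat) : nat :=
  if n == 6%N then 1%N else if n == 7%N then 0%N else 7%N.

(* chambers c, d contain the same point (vertex of type point_type n) *)
Definition same_point (n : nat) (C : Type) (delta : C -> C -> 'M[int]_n) (c d : C) : Prop :=
  exists s : seq 'I_n, all (fun i : 'I_n => nat_of_ord i != point_type n) s /\ delta c d = prodgen s.

Definition collinear (n : nat) (C : Type) (delta : C -> C -> 'M[int]_n) (c d : C) : Prop :=
  ~ same_point delta c d /\
  exists c' d' (i : 'I_n), same_point delta c c' /\ same_point delta d d' /\
    nat_of_ord i = point_type n /\ delta c' d' = gen i.

Definition position2' (n : nat) (C : Type) (delta : C -> C -> 'M[int]_n) (c d : C) : Prop :=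
  ~ same_point delta c d /\ ~ collinear delta c d /\
  exists z, collinear delta c z /\ collinear delta z d /\
    forall z', collinear delta c z' -> collinear delta z' d -> same_point delta z z'.

Definition polar_kangaroo (n : nat) (C : Type) (delta : C -> C -> 'M[int]_n) (theta : C -> C) : Prop :=
  forall c, ~ collinear delta c (theta c) /\ ~ position2' delta c (theta c).

(* Main.v *)
(* Let [D] be the set of displacements delta(c, theta c). The mutual position of two points is
   read off from w = delta(c, d) as <h, w h>, [h] the highest root: the values 2, 1, 0, -1, -2
   stand for the positions 0, 1, 2, 2', 3. So the kangaroo condition says that no w in [D] has
   <h, w h> = 1 or -1.

   Suppose that some chamber is opposite its image, but not all are. By connectedness of the
   building, [D] contains w0 and some s_i w0. Looking at the residues of type A_2, where theta
   induces dualities of projective planes, one passes from s_i w0 in [D] to s_j w0 in [D] for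
   every neighbour j of i, so one reaches s_p w0, [p] being the type of the points. But
   <h, s_p w0 h> = -1.

   Suppose that theta preserves types, fixes a chamber and is not trivial. Then [D] contains some
   s_i, and if it contains the reflection in a positive root b with <b, a_j> < 0, it contains the
   one in s_j b > b. Going up in this way one meets a root b with <h, b> = 1, and
   <h, s_b h> = 1. *)
Require Import Defs.
From mathcomp Require Import all_boot all_order all_algebra.
From mathcomp Require Import zify ring lra.
From Stdlib Require Import Classical.
Set Implicit Arguments. Unset Strict Implicit. Unset Printing Implicit Defensive.
Import Order.TTheory GRing.Theory Num.Theory.
Local Open Scope ring_scope.

(** * The Cartan form *)

Section CartanForm.
Variable n : nat.
Implicit Types (i j k : 'I_n) (u v x y : 'cV[int]_n) (r s : seq 'I_n).

Definition ip u v : int := (u^T *m cartan n *m v) 0 0.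
Definition sroot i : 'cV[int]_n := delta_mx i 0.
Definition nonneg v := forall k, 0 <= v k 0.

Lemma tr_cartan : (cartan n)^T = cartan n.
Proof. by apply/matrixP=> i j; rewrite !mxE eq_sym orbC. Qed.

Lemma ipC u v : ip u v = ip v u.
Proof.
rewrite /ip -[in LHS](trmxK (_ *m v)) [LHS]mxE trmx_mul trmx_mul trmxK tr_cartan.
by rewrite mulmxA.
Qed.

Lemma ipDr u v x : ip u (v + x) = ip u v + ip u x.
Proof. by rewrite /ip mulmxDr mxE. Qed.
Lemma ipZr u a v : ip u (a *: v) = a * ip u v.
Proof. by rewrite /ip -scalemxAr mxE. Qed.
Lemma ipNr u v : ip u (- v) = - ip u v.
Proof. by rewrite /ip mulmxN mxE. Qed.
Lemma ipBr u v x : ip u (v - x) = ip u v - ip u x.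
Proof. by rewrite ipDr ipNr. Qed.
Lemma ipDl u v x : ip (u + v) x = ip u x + ip v x.
Proof. by rewrite ipC ipDr ![ip x _]ipC. Qed.
Lemma ipZl u a v : ip (a *: u) v = a * ip u v.
Proof. by rewrite ipC ipZr ipC. Qed.
Lemma ipNl u v : ip (- u) v = - ip u v.
Proof. by rewrite ipC ipNr ipC. Qed.
Definition ipE := (ipDr, ipZr, ipNr, ipDl, ipZl, ipNl).

Lemma ip_sum u v : ip u v = \sum_i \sum_j u i 0 * cartan n i j * v j 0.
Proof.
rewrite /ip mxE exchange_big /=; apply: eq_bigr => j _.
by rewrite mxE mulr_suml; apply: eq_bigr => i _; rewrite mxE.
Qed.

Lemma ip_sroot i v : ip (sroot i) v = (cartan n *m v) i 0.
Proof. by rewrite /ip /sroot trmx_delta -mulmxA -rowE mxE. Qed.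

Lemma sum_sroot v : v = \sum_i v i 0 *: sroot i.
Proof.
apply/matrixP=> j c; rewrite ord1 summxE (bigD1 j) //= !mxE !eqxx mulr1.
by rewrite big1 ?addr0 // => i ij; rewrite !mxE eq_sym (negPf ij) mulr0.
Qed.

Lemma ip_sroots i j : ip (sroot i) (sroot j) = cartan n i j.
Proof. by rewrite ip_sroot -colE mxE. Qed.

Lemma cartan_diag i : cartan n i i = 2.
Proof. by rewrite mxE eqxx. Qed.

Lemma ip_sumr u v : ip u v = \sum_i v i 0 * ip u (sroot i).
Proof.
rewrite {1}(sum_sroot v) (big_morph (ip u) (ipDr u) (id1 := 0)); last first.
  by rewrite /ip mulmx0 mxE.
by apply: eq_bigr => i _; rewrite ipZr.
Qed.

Lemma gen_act i v : gen i *m v = v - ip (sroot i) v *: sroot i.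
Proof.
rewrite /gen mulmxBl mul1mx ip_sroot -mulmxA -(mul_delta_mx (0 : 'I_1)) -mulmxA.
by rewrite -rowE [row _ _]mx11_scalar mul_mx_scalar mxE.
Qed.

Lemma mulmx_sroot_inj (A B : 'M[int]_n) : (forall i, A *m sroot i = B *m sroot i) -> A = B.
Proof.
move=> AB; apply/matrixP=> i j; move/matrixP/(_ i 0): (AB j).
by rewrite /sroot -!colE !mxE.
Qed.

Lemma mulmx_cV_inj (A B : 'M[int]_n) : (forall v, A *m v = B *m v) -> A = B.
Proof. by move=> AB; apply: mulmx_sroot_inj => i; apply: AB. Qed.

Lemma gen_sroot i : gen i *m sroot i = - sroot i.
Proof.
by rewrite gen_act ip_sroots cartan_diag scaler_nat mulr2n opprD addrA subrr sub0r.
Qed.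

Lemma gen_gen i : gen i *m gen i = 1%:M.
Proof.
apply: mulmx_cV_inj => v; rewrite -mulmxA mul1mx [gen i *m v]gen_act mulmxBr.
by rewrite -scalemxAr gen_sroot gen_act scalerN opprK subrK.
Qed.

Lemma ip_gen i u v : ip (gen i *m u) (gen i *m v) = ip u v.
Proof.
rewrite !gen_act !ipE ip_sroots cartan_diag (ipC u (sroot i)); ring.
Qed.

Lemma ip_gen_adj i u v : ip (gen i *m u) v = ip u (gen i *m v).
Proof. by rewrite -(ip_gen i) mulmxA gen_gen mul1mx. Qed.

Lemma prodgen_cat r s : prodgen (r ++ s) = prodgen r *m prodgen s.
Proof. by elim: r => [|i r IH] /=; rewrite ?mul1mx // IH mulmxA. Qed.

Lemma prodgen1 i : prodgen [:: i] = gen i.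
Proof. by rewrite /= mulmx1. Qed.

Lemma prodgen_rcons r i : prodgen (rcons r i) = prodgen r *m gen i.
Proof. by rewrite -cats1 prodgen_cat prodgen1. Qed.

Lemma prodgen_revK s : prodgen (rev s) *m prodgen s = 1%:M.
Proof.
elim: s => [|i s IH] /=; first by rewrite mulmx1.
by rewrite rev_cons prodgen_rcons -mulmxA (mulmxA (gen i)) gen_gen mul1mx.
Qed.

Lemma prodgenK_rev s : prodgen s *m prodgen (rev s) = 1%:M.
Proof. by rewrite -{1}(revK s) prodgen_revK. Qed.

Lemma ip_prodgen r u v : ip (prodgen r *m u) (prodgen r *m v) = ip u v.
Proof. by elim: r => [|i r IH] /=; rewrite ?mul1mx // -!mulmxA ip_gen. Qed.

Lemma ip_prodgen_adj r u v : ip (prodgen r *m u) v = ip u (prodgen (rev r) *m v).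
Proof.
by rewrite -(ip_prodgen (rev r)) mulmxA prodgen_revK mul1mx.
Qed.

(* [g s_i g^-1] is the reflection in [g (alpha_i)]. *)
Lemma gen_conj r i j : prodgen r *m sroot i = sroot j ->
  gen j *m prodgen r = prodgen r *m gen i.
Proof.
move=> rij; apply: mulmx_cV_inj => v; rewrite -!mulmxA gen_act gen_act.
by rewrite -rij ip_prodgen mulmxBr -scalemxAr.
Qed.

Lemma coordN v k : (- v) k 0 = - v k 0. Proof. by rewrite mxE. Qed.
Lemma coordD u v k : (u + v) k 0 = u k 0 + v k 0. Proof. by rewrite mxE. Qed.
Lemma coordZ a v k : (a *: v) k 0 = a * v k 0. Proof. by rewrite mxE. Qed.
Lemma coord_sroot i k : sroot i k 0 = (k == i)%:R.
Proof. by rewrite mxE eqxx andbT. Qed.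
Definition coordE := (coordD, coordN, coordZ, coord_sroot).

Lemma gen_coord i j v : j != i -> (gen i *m v) j 0 = v j 0.
Proof. by move=> ji; rewrite gen_act !mxE (negPf ji) mulr0 subr0. Qed.

Lemma sroot_ge0 i : nonneg (sroot i).
Proof. by move=> k; rewrite mxE ler0n. Qed.

Lemma gen_perp i v : ip (sroot i) v = 0 -> gen i *m v = v.
Proof. by rewrite gen_act => ->; rewrite scale0r subr0. Qed.

Lemma cartanC i j : cartan n i j = cartan n j i.
Proof. by rewrite -{1}tr_cartan mxE. Qed.

Lemma gen_sroot_edge i j : cartan n i j = -1 -> gen i *m sroot j = sroot i + sroot j.
Proof. by move=> ij; rewrite gen_act ip_sroots ij scaleN1r opprK addrC. Qed.

(** $s_is_j$ sends $\alpha_i$ to $\alpha_j$, hence conjugates $s_i$ into $s_j$. *)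
Lemma braid i j : cartan n i j = -1 ->
  gen i *m gen j *m gen i = gen j *m gen i *m gen j.
Proof.
move=> ij; have := @gen_conj [:: i; j] i j; rewrite /= mulmx1 => E.
rewrite -E ?mulmxA // -mulmxA (gen_sroot_edge (i := j)) 1?cartanC //.
by rewrite mulmxDr gen_sroot gen_sroot_edge // addrC addKr.
Qed.

End CartanForm.

Definition En (n : nat) : Prop := n = 6%N \/ n = 7%N \/ n = 8%N.

(** * Positive definiteness of the form *)

Section Definiteness.

(** Padding by zeros places the lattices of $E_6$ and $E_7$ in that of $E_8$, so that a single form
    [qform], half the norm of $E_8$, serves all three types. *)
Definition zext n (v : 'cV[int]_n) (k : nat) : int :=
  oapp (fun i => v i 0) 0 (insub k : option 'I_n).

Lemma zext_ord n (v : 'cV[int]_n) (i : 'I_n) : zext v i = v i 0.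
Proof. by rewrite /zext valK. Qed.

Lemma zext_out n (v : 'cV[int]_n) k : (n <= k)%N -> zext v k = 0.
Proof. by move=> nk; rewrite /zext insubN // -leqNgt. Qed.

Definition cnat (i j : nat) : int :=
  if i == j then 2 else if En_edge i j || En_edge j i then -1 else 0.

Lemma ip_zext n (u v : 'cV[int]_n) :
  ip u v = \sum_(0 <= i < n) \sum_(0 <= j < n) zext u i * cnat i j * zext v j.
Proof.
rewrite ip_sum big_mkord; apply: eq_bigr => i _.
by rewrite big_mkord; apply: eq_bigr => j _; rewrite !zext_ord mxE.
Qed.

Definition qform (x : nat -> int) : int :=
  x 0 * x 0 + x 1 * x 1 + x 2 * x 2 + x 3 * x 3 + x 4 * x 4 + x 5 * x 5 + x 6 * x 6 + x 7 * x 7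
  - (x 0 * x 2 + x 2 * x 3 + x 3 * x 4 + x 4 * x 5 + x 5 * x 6 + x 6 * x 7 + x 1 * x 3).

Lemma ip_qform n (v : 'cV[int]_n) (Hn : En n) : ip v v = 2 * qform (zext v).
Proof.
rewrite ip_zext /qform.
have z6 : (n <= 6)%N -> zext v 6 = 0 by apply: zext_out.
have z7 : (n <= 7)%N -> zext v 7 = 0 by apply: zext_out.
move: (zext v) z6 z7 => x; case: Hn => [->|[->|->]] z6 z7;
  rewrite /index_iota !subn0 /= !(big_cons, big_nil) /cnat /En_edge /=.
- rewrite z6 // z7 //; ring.
- rewrite z7 //; ring.
- ring.
Qed.

(* Completing the square along the tree, from the leaves towards the branch node. *)
Lemma qform_squares x : 120 * qform x =
  30 * (2 * x 0 - x 2) ^+ 2 + 10 * (3 * x 2 - 2 * x 3) ^+ 2 + 30 * (2 * x 1 - x 3) ^+ 2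
  + 30 * (2 * x 7 - x 6) ^+ 2 + 10 * (3 * x 6 - 2 * x 5) ^+ 2 + 5 * (4 * x 5 - 3 * x 4) ^+ 2
  + 3 * (5 * x 4 - 4 * x 3) ^+ 2 + 2 * (x 3) ^+ 2.
Proof. rewrite /qform; ring. Qed.

Lemma natmul_sqr_ge0 (m : nat) (a : int) : 0 <= m%:R * a ^+ 2.
Proof. by rewrite mulr_ge0 ?ler0n ?sqr_ge0. Qed.

Lemma qform_ge0 x : 0 <= qform x.
Proof.
by rewrite -(pmulr_rge0 _ (isT : (0 : int) < 120)) qform_squares !addr_ge0 ?natmul_sqr_ge0.
Qed.

Lemma qform_eq0 x : qform x = 0 -> forall k, (k < 8)%N -> x k = 0.
Proof.
move=> q0 k; have := qform_squares x; rewrite q0 mulr0 => /esym.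
move/eqP; rewrite !paddr_eq0 ?addr_ge0 ?natmul_sqr_ge0 //.
rewrite !mulf_eq0 /= !orbb => /andP[/andP[/andP[/andP[/andP[/andP[/andP[
  /eqP h0 /eqP h1] /eqP h2] /eqP h3] /eqP h4] /eqP h5] /eqP h6] /eqP h7].
move=> k8.
have e3 : x 3%N = 0 by [].
have e2 : x 2%N = 0 by lra.
have e4 : x 4%N = 0 by lra.
have e5 : x 5%N = 0 by lra.
have e6 : x 6%N = 0 by lra.
have e0 : x 0%N = 0 by lra.
have e1 : x 1%N = 0 by lra.
have e7 : x 7%N = 0 by lra.
by move: k k8; do 8 case=> //.
Qed.

End Definiteness.

(** * Roots and their signs *)

Section RootSigns.
Variables (n : nat) (Hn : En n).
Implicit Types (i j k : 'I_n) (u v x y : 'cV[int]_n) (r s : seq 'I_n).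

Lemma ip_ge0 v : 0 <= ip v v.
Proof. by rewrite ip_qform // mulr_ge0 // qform_ge0. Qed.

Lemma ip_eq0 v : ip v v = 0 -> v = 0.
Proof.
rewrite ip_qform // => /eqP; rewrite mulf_eq0 /= => /eqP /qform_eq0 v0.
apply/matrixP=> i c; rewrite ord1 mxE -zext_ord v0 //.
by apply: (leq_trans (ltn_ord i)); case: (Hn) => [|[]] ->.
Qed.

(** The form is even and positive definite. *)
Lemma ip_lt2 v : ip v v < 2 -> v = 0.
Proof. by move=> v2; apply: ip_eq0; have := ip_ge0 v; move: v2; rewrite ip_qform //; lia. Qed.

(** In these simply laced types the roots are exactly the lattice vectors of norm 2. *)
Definition is_root v := ip v v = 2.

Lemma root_prodgen r v : is_root v -> is_root (prodgen r *m v).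
Proof. by rewrite /is_root ip_prodgen. Qed.

Lemma root_gen i v : is_root v -> is_root (gen i *m v).
Proof. by rewrite /is_root ip_gen. Qed.

Lemma root_sroot i : is_root (sroot i).
Proof. by rewrite /is_root ip_sroots cartan_diag. Qed.

Lemma is_rootN v : is_root v -> is_root (- v).
Proof. by rewrite /is_root !ipE opprK. Qed.

(** The norm of $u-v$ is $4-2\langle u,v\rangle\le 0$. *)
Lemma root_eq u v : is_root u -> is_root v -> 2 <= ip u v -> u = v.
Proof.
rewrite /is_root => u2 v2 uv; apply/eqP; rewrite -subr_eq0; apply/eqP/ip_lt2.
by rewrite !ipE u2 v2 (ipC v u); lia.
Qed.

Lemma root_ip_le1 u v : is_root u -> is_root v -> u <> v -> ip u v <= 1.
Proof.
by move=> ru rv uv; rewrite leNgt; apply/negP => ?; apply: uv; apply: root_eq => //; lia.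
Qed.

(* The positive and negative parts of [v] have non-positive inner product, and a nonzero
   vector has norm at least 2; so if both were nonzero, [v] would have norm at least 4. *)
Lemma root_sign v : is_root v -> nonneg v \/ nonneg (- v).
Proof.
move=> rv; pose a := \col_k Num.max (v k 0) 0; pose b := \col_k Num.max (- v k 0) 0.
have vab : v = a - b by apply/matrixP=> k c; rewrite ord1 !mxE; lia.
have ab_le0 : ip a b <= 0.
  rewrite ip_sum; apply: sumr_le0 => i _; apply: sumr_le0 => j _; rewrite !mxE.
  case: eqP => [<-|_]; first by case: (lerP 0 (v i 0)) => ?; nia.
  by case: ifP => _; nia.
have [a0|/ip_lt2 a0] := lerP 2 (ip a a); last first.
  by right => k; rewrite vab a0 sub0r opprK mxE le_max lexx orbT.
have [b0|/ip_lt2 b0] := lerP 2 (ip b b); last first.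
  by left => k; rewrite vab b0 subr0 mxE le_max lexx orbT.
by move: rv; rewrite /is_root vab !ipE (ipC b a); lia.
Qed.

Lemma root_neg v : is_root v -> ~ nonneg v -> nonneg (- v).
Proof. by move=> /root_sign[]. Qed.

Lemma root_pos_coord v k : is_root v -> 0 < v k 0 -> nonneg v.
Proof. by move=> /root_sign[] // /(_ k) v1 v2; exfalso; move: v1 v2; rewrite coordN; lia. Qed.

Lemma root_neg_coord v k : is_root v -> v k 0 < 0 -> nonneg (- v).
Proof. by move=> /root_sign[] // /(_ k) v1 v2; exfalso; move: v1 v2; lia. Qed.

Lemma nonneg_N v : nonneg v -> nonneg (- v) -> v = 0.
Proof.
move=> v1 v2; apply/matrixP=> i c; rewrite ord1.
by have := v1 i; have := v2 i; rewrite coordN mxE; lia.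
Qed.

Lemma root_neq0 v : is_root v -> v <> 0.
Proof. by move=> rv v0; move: rv; rewrite /is_root v0 /ip mulmx0 mxE. Qed.

(** Since $s_i$ changes only the coordinate at $i$, all other coordinates of $v$ must vanish. *)
Lemma gen_neg_sroot i v : is_root v -> nonneg v -> nonneg (- (gen i *m v)) -> v = sroot i.
Proof.
move=> rv v0 gv0.
have vE : v = v i 0 *: sroot i.
  apply/matrixP=> k c; rewrite ord1 !coordE.
  have [->|ki] := eqVneq k i; first by rewrite mulr1.
  have vk0 := v0 k; have := gv0 k; rewrite coordN gen_coord // mulr0 => ?; lia.
have vi := v0 i; apply: root_eq => //; first exact: root_sroot.
by move: rv; rewrite /is_root vE !ipE ip_sroots cartan_diag; nia.
Qed.

End RootSigns.

(** * Length and longest element *)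

Section Length.
Variables (n : nat) (Hn : En n).
Implicit Types (i j k : 'I_n) (u v x y : 'cV[int]_n) (r s : seq 'I_n).

(** Apply the letters of [r] to $\alpha_i$ from the right. Where the image first turns negative, it
    was the simple root of the letter $j$ being applied; conjugation then turns $s_i$ into $s_j$,
    which cancels this letter. *)
Lemma exchange r i : nonneg (- (prodgen r *m sroot i)) ->
  exists r', size r = (size r').+1 /\ prodgen r' = prodgen r *m gen i.
Proof.
elim: r => [|j r IH] /=.
  rewrite mul1mx => ai; have := root_neq0 (root_sroot i).
  by case; apply: nonneg_N ai; apply: sroot_ge0.
rewrite -mulmxA => jr.
have rr : is_root (prodgen r *m sroot i) by apply/root_prodgen/root_sroot.
have [rp|/IH[r' [sr' r'E]]] := root_sign Hn rr; last first.
  by exists (j :: r'); rewrite /= sr' r'E mulmxA.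
exists r; split=> //.
by rewrite (gen_conj (gen_neg_sroot Hn rr rp jr)) -mulmxA gen_gen mulmx1.
Qed.

Lemma prodgen_rev_eq r s : prodgen r = prodgen s -> prodgen (rev r) = prodgen (rev s).
Proof.
by move=> rs; rewrite -[LHS]mulmx1 -(prodgenK_rev s) mulmxA -rs prodgen_revK mul1mx.
Qed.

Lemma len_is_rev r m : len_is (prodgen r) m -> len_is (prodgen (rev r)) m.
Proof.
case=> [[s [<- rs]] min_s]; split.
  by exists (rev s); rewrite size_rev (prodgen_rev_eq rs).
by move=> t /prodgen_rev_eq; rewrite revK => /min_s; rewrite size_rev.
Qed.

Lemma len_is_exists (w : 'M[int]_n) : in_W w -> exists m, len_is w m.
Proof.
case=> s0 ws0.
have ex : exists m, [exists t : m.-tuple 'I_n, w == prodgen t].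
  by exists (size s0); apply/existsP; exists (in_tuple s0); apply/eqP.
exists (ex_minn ex); case: ex_minnP => m /existsP[t /eqP wt] min_m; split.
  by exists t; rewrite size_tuple.
by move=> s ws; apply: min_m; apply/existsP; exists (in_tuple s); apply/eqP.
Qed.

(** If [t] is a word for $s_iw$, exchange applied to its reverse deletes a letter and leaves a word
    for $w^{-1}$, so [t] has at least $m+1$ letters. *)
Lemma len_gen_up s i m : nonneg (prodgen (rev s) *m sroot i) ->
  len_is (prodgen s) m -> len_is (gen i *m prodgen s) m.+1.
Proof.
move=> si [[r [<- sr]] min_s]; split; first by exists (i :: r); rewrite sr.
move=> t st; have stE : prodgen s = prodgen (i :: t).
  by rewrite /= -st mulmxA gen_gen mul1mx.
have sE : prodgen (rev s) = prodgen (rev t) *m gen i.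
  by rewrite (prodgen_rev_eq stE) rev_cons prodgen_rcons.
have [|t' [tt' t'E]] := @exchange (rev t) i.
  by move: si; rewrite sE -mulmxA gen_sroot mulmxN.
rewrite size_rev in tt'; rewrite tt' ltnS -(size_rev t'); apply: min_s.
by rewrite -sE in t'E; rewrite (prodgen_rev_eq t'E) revK.
Qed.

Lemma prodgen_pos_eq1 r : (forall i, nonneg (prodgen r *m sroot i)) -> prodgen r = 1%:M.
Proof.
have [m] := ubnP (size r); elim: m r => // m IH r.
case/lastP: r => [//|r i]; rewrite size_rcons !ltnS => rm pos.
have [|r' [rr' r'E]] := @exchange r i.
  by have := pos i; rewrite prodgen_rcons -mulmxA gen_sroot mulmxN.
rewrite prodgen_rcons -r'E; apply: IH; first by rewrite rr' in rm; apply: ltnW.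
by move=> j; rewrite r'E -prodgen_rcons.
Qed.

End Length.

(** * Computing with coordinate lists *)

Section CoordinateLists.
Variables (n : nat).

Definition lvec (l : seq int) : 'cV[int]_n := \col_i nth 0 l i.
Definition lip (i : nat) (l : seq int) : int :=
  foldr (fun j a => cnat i j * nth 0 l j + a) 0 (iota 0 n).
Definition lrefl (i : nat) (l : seq int) : seq int :=
  set_nth 0 l i (nth 0 l i - lip i l).

Lemma lipE (i : 'I_n) l : ip (sroot i) (lvec l) = lip i l.
Proof.
rewrite ip_sroot mxE /lip.
transitivity (\sum_(0 <= j < n) cnat i j * nth 0 l j); last first.
  by rewrite /index_iota subn0 unlock.
by rewrite big_mkord; apply: eq_bigr => j _; rewrite !mxE.
Qed.

Lemma lreflE (i : 'I_n) l : gen i *m lvec l = lvec (lrefl i l).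
Proof.
apply/matrixP=> k c; rewrite ord1 gen_act !coordE lipE !mxE nth_set_nth /=.
have [->|ki] := eqVneq k i; first by rewrite eqxx mulr1.
by rewrite val_eqE (negPf ki) mulr0 subr0.
Qed.

Lemma prodgen_lvec (s : seq 'I_n) l :
  prodgen s *m lvec l = lvec (foldr lrefl l (map val s)).
Proof. by elim: s => [|i s IH] /=; rewrite ?mul1mx // -mulmxA IH lreflE. Qed.

Lemma sroot_lvec (i : 'I_n) : sroot i = lvec (mkseq (fun k => (k == i)%:R) n).
Proof. by apply/matrixP=> k c; rewrite ord1 coord_sroot mxE nth_mkseq. Qed.

Lemma ord_word (w : seq nat) : all (fun i => i < n)%N w ->
  exists s : seq 'I_n, map val s = w.
Proof.
elim: w => [|i w IH] /=; first by exists [::].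
by case/andP=> lt_in /IH[s <-]; exists (Ordinal lt_in :: s).
Qed.

End CoordinateLists.

(* A power of a Coxeter element: [c ^ (h / 2)] is the longest element, [h] the Coxeter number. *)
Definition w0_word (n : nat) : seq nat :=
  if n == 6%N then flatten (nseq 6 [:: 0; 3; 5; 1; 2; 4]%N)
  else if n == 7%N then flatten (nseq 9 (iota 0 7)) else flatten (nseq 15 (iota 0 8)).

Definition highest_coef (n : nat) : seq int :=
  if n == 6%N then [:: 1; 2; 2; 3; 2; 1]
  else if n == 7%N then [:: 2; 2; 3; 4; 3; 2; 1] else [:: 2; 3; 4; 6; 5; 4; 3; 2].

Section LongestElement.
Variables (n : nat) (Hn : En n).
Implicit Types (i j k : 'I_n) (u v x y : 'cV[int]_n) (r s : seq 'I_n).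

Lemma sigma_nat_lt i : (sigma_nat n i < n)%N.
Proof.
have := ltn_ord i; move: (nat_of_ord i); case: Hn => [->|[->|->]] //.
by do 6 case=> //.
Qed.

Definition sg i : 'I_n := Ordinal (sigma_nat_lt i).

Lemma sgK i : sg (sg i) = i.
Proof.
apply: val_inj; rewrite /= /sigma_nat; case: (n == 6%N) => //.
by move: (nat_of_ord i); do 6 case=> //.
Qed.

Lemma Psigma_sroot i : Psigma n *m sroot i = sroot (sg i).
Proof. by apply/matrixP=> k c; rewrite ord1 coord_sroot -colE !mxE -val_eqE /=; case: ifP. Qed.

Lemma PsigmaK : Psigma n *m Psigma n = 1%:M.
Proof. by apply: mulmx_sroot_inj => i; rewrite -mulmxA !Psigma_sroot sgK mul1mx. Qed.

Lemma w0_word_act : all (fun a => all (fun b =>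
    nth 0 (foldr (lrefl n) (mkseq (fun c => (c == a)%:R) n) (w0_word n)) b
      == - (b == sigma_nat n a)%:R) (iota 0 n)) (iota 0 n).
Proof. by case: Hn => [->|[->|->]]; vm_compute. Qed.

(** The longest element is $-1$ in types $E_7$ and $E_8$, and minus the diagram automorphism in type
    $E_6$. An explicit word is evaluated on the simple roots. *)
Lemma w0_in_W : exists r, prodgen r = - Psigma n.
Proof.
have [|r rw] := @ord_word n (w0_word n); first by case: Hn => [->|[->|->]].
exists r; apply: mulmx_sroot_inj => i.
rewrite mulNmx Psigma_sroot sroot_lvec prodgen_lvec rw.
apply/matrixP=> k c; rewrite ord1 coordN coord_sroot mxE.
have /allP/(_ i) := w0_word_act; rewrite mem_iota /= => /(_ (ltn_ord i)).
by move/allP/(_ k); rewrite mem_iota /= => /(_ (ltn_ord k)) /eqP ->.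
Qed.

Lemma ip_Psigma u v : ip (Psigma n *m u) (Psigma n *m v) = ip u v.
Proof.
have [r rE] := w0_in_W.
by rewrite -[RHS](ip_prodgen r) rE !mulNmx ipNl ipNr opprK.
Qed.

Lemma Psigma_gen i : Psigma n *m gen i = gen (sg i) *m Psigma n.
Proof.
apply: mulmx_cV_inj => v; rewrite -!mulmxA !gen_act.
by rewrite mulmxBr -scalemxAr -Psigma_sroot ip_Psigma.
Qed.

Lemma opp_twist_gen i : opp_twist (gen i) = gen (sg i).
Proof. by rewrite /opp_twist Psigma_gen -mulmxA PsigmaK mulmx1. Qed.

(** If $w\alpha_i$ were positive, $s_iw^{-1}$ would be longer than $w$. So $w$ makes all simple
    roots negative, and $w\cdot(-\Psi)$ keeps them positive, hence is 1. *)
Lemma longest_eq (w : 'M[int]_n) m : in_W w -> len_is w m ->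
  (forall (w' : 'M[int]_n) m', in_W w' -> len_is w' m' -> (m' <= m)%N) -> w = - Psigma n.
Proof.
move=> [r ->] len_w max_m; have len_r := len_is_rev len_w; have [r0 r0E] := w0_in_W.
have neg i : nonneg (- (prodgen r *m sroot i)).
  apply: (root_neg Hn) => [|pos]; first exact/root_prodgen/root_sroot.
  suff : (m.+1 <= m)%N by rewrite ltnn.
  apply: (max_m (prodgen (i :: rev r))); first by eexists.
  by apply: (len_gen_up Hn) => //; rewrite revK.
have : prodgen (r ++ r0) = 1%:M.
  apply: (prodgen_pos_eq1 Hn) => i.
  by rewrite prodgen_cat -mulmxA r0E mulNmx Psigma_sroot mulmxN.
rewrite prodgen_cat r0E mulmxN => /(congr1 (fun A => - A *m Psigma n)).
by rewrite opprK -mulmxA PsigmaK mulmx1 mulNmx mul1mx.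
Qed.

End LongestElement.

(** * The highest root *)

Section Heights.
Variables (n : nat) (Hn : En n) (p : 'I_n).
Implicit Types (i j k : 'I_n) (u v x y : 'cV[int]_n) (r s : seq 'I_n).

Definition height v : int := \sum_i v i 0.

Lemma heightB u v : height (u - v) = height u - height v.
Proof. by rewrite -sumrB; apply: eq_bigr => i _; rewrite !coordE. Qed.

Lemma height_sroot i : height (sroot i) = 1.
Proof.
rewrite /height (bigD1 i) //= coord_sroot eqxx big1 ?addr0 // => j ji.
by rewrite coord_sroot (negPf ji).
Qed.

Lemma height_gen i v : height (gen i *m v) = height v - ip (sroot i) v.
Proof.
rewrite gen_act heightB; congr (_ - _).
rewrite -[RHS]mulr1 -(height_sroot i) /height mulr_sumr.
by apply: eq_bigr => j _; rewrite coordZ.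
Qed.

Lemma height_ge0 v : nonneg v -> 0 <= height v.
Proof. by move=> v0; apply: sumr_ge0. Qed.

Lemma ip_sroot_le1 v j : is_root v -> v p 0 = 1 -> j != p -> ip (sroot j) v <= 1.
Proof.
move=> rv vp jp; apply: (root_ip_le1 Hn) => //; first exact: root_sroot.
by move=> jv; move: vp; rewrite -jv coord_sroot eq_sym (negPf jp).
Qed.

(** Reflections in simple roots other than $\alpha_p$ lower the height by exactly 1 each, until
    $\alpha_p$ is reached; so the height determines the number of letters. *)
Lemma root_descent v : is_root v -> v p 0 = 1 ->
  exists s, [/\ all (fun i => i != p) s, v = prodgen s *m sroot p
              & height v = (size s)%:Z + 1].
Proof.
move=> rv vp; have v0 : nonneg v by apply: (@root_pos_coord _ Hn _ p); rewrite // vp.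
have [m] := ubnP `|height v|%N; elim: m v rv vp v0 => // m IH v rv vp v0 hm.
have [->|vNp] := eqVneq v (sroot p).
  by exists [::]; rewrite /= mul1mx height_sroot.
(* Otherwise, expanding $\langle v,v\rangle=2$ along the coordinates of the second $v$ gives
   $\langle v,\alpha_p\rangle\ge 2$. *)
have /existsP[j /andP[jp jv]] : [exists j, (j != p) && (0 < ip (sroot j) v)].
  apply: contra_neqT vNp => /existsPn noj; apply: (root_eq Hn) => //.
    exact: root_sroot.
  rewrite -[leLHS]rv [leLHS]ip_sumr (bigD1 p) //= vp mul1r gerDl.
  apply: sumr_le0 => i ip; have := noj i; rewrite ip /= -leNgt ipC => ?.
  exact: mulr_ge0_le0.
have jv1 : ip (sroot j) v = 1 by have := ip_sroot_le1 rv vp jp; lia.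
have hg := height_gen j v.
have gp : (gen j *m v) p 0 = 1 by rewrite gen_coord // eq_sym.
have g0 : nonneg (gen j *m v).
  by apply: (@root_pos_coord _ Hn _ p); [apply: root_gen | rewrite gp].
have [|s [sp vE hs]] := IH _ (root_gen j rv) gp g0.
  by have := height_ge0 g0; have := height_ge0 v0; move: hm; rewrite hg jv1; lia.
exists (j :: s); split; first by rewrite /= jp.
  by rewrite /= -mulmxA -vE mulmxA gen_gen mul1mx.
by move: hs; rewrite hg jv1 /=; lia.
Qed.

End Heights.

Section HighestRoot.
Variables (n : nat) (Hn : En n) (p : 'I_n) (Hp : nat_of_ord p = point_type n).
Implicit Types (i j k : 'I_n) (u v x y : 'cV[int]_n) (r s : seq 'I_n).

Definition hroot : 'cV[int]_n := lvec n (highest_coef n).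

Lemma hroot_p : hroot p 0 = 2.
Proof. by rewrite mxE Hp; case: Hn => [->|[->|->]]. Qed.

Lemma lip_hroot : all (fun a => lip n a (highest_coef n) == (a == point_type n)%:R) (iota 0 n).
Proof. by case: Hn => [->|[->|->]]; vm_compute. Qed.

Lemma ip_sroot_hroot i : ip (sroot i) hroot = (i == p)%:R.
Proof.
rewrite lipE; have /allP/(_ i) := lip_hroot; rewrite mem_iota => /(_ (ltn_ord i)) /eqP ->.
by rewrite -Hp.
Qed.

(** The highest root is the fundamental weight at [p]. *)
Lemma ip_hroot v : ip hroot v = v p 0.
Proof.
rewrite ip_sumr (bigD1 p) //= ipC ip_sroot_hroot eqxx mulr1 big1 ?addr0 // => i ip.
by rewrite ipC ip_sroot_hroot (negPf ip) mulr0.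
Qed.

Lemma root_hroot : is_root hroot.
Proof. by rewrite /is_root ip_hroot hroot_p. Qed.

Lemma gen_hroot i : i != p -> gen i *m hroot = hroot.
Proof. by move=> ip; apply: gen_perp; rewrite ip_sroot_hroot (negPf ip). Qed.

Lemma genp_hroot : gen p *m hroot = hroot - sroot p.
Proof. by rewrite gen_act ip_sroot_hroot eqxx scale1r. Qed.

Lemma prodgen_hroot r : all (fun i => i != p) r -> prodgen r *m hroot = hroot.
Proof.
elim: r => [|i r IH] /=; first by rewrite mul1mx.
by case/andP=> ip /IH rh; rewrite -mulmxA rh gen_hroot.
Qed.

Lemma sg_p : sg Hn p = p.
Proof. by apply: val_inj; rewrite /= Hp; case: Hn => [->|[->|->]]. Qed.

Lemma Psigma_hroot : Psigma n *m hroot = hroot.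
Proof.
suff ip0 i : ip (sroot i) (Psigma n *m hroot - hroot) = 0.
  apply/eqP; rewrite -subr_eq0; apply/eqP/(ip_eq0 Hn).
  by rewrite ip_sumr big1 // => i _; rewrite ipC ip0 mulr0.
have -> : sroot i = Psigma n *m sroot (sg Hn i) by rewrite Psigma_sroot sgK.
rewrite ipBr ip_Psigma // Psigma_sroot !ip_sroot_hroot.
by rewrite -{2}sg_p (can_eq (sgK Hn)) subrr.
Qed.

(** If the last letter $i$ shortens the word, exchange applies. Otherwise $w$ makes $\alpha_i$
    negative; then $i\ne p$, as $\langle h,w\alpha_p\rangle=\langle h,\alpha_p\rangle=1$, and the
    letter can be split off. *)
Lemma stab_hroot r : prodgen r *m hroot = hroot ->
  exists s, all (fun i => i != p) s /\ prodgen r = prodgen s.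
Proof.
have [m] := ubnP (size r); elim: m r => // m IH r.
case/lastP: r => [|r i]; first by exists [::].
rewrite size_rcons !ltnS => rm rh.
have rr : is_root (prodgen (rcons r i) *m sroot i) by apply/root_prodgen/root_sroot.
have [rpos|rneg] := root_sign Hn rr.
  have [|r' [rr' r'E]] := @exchange n Hn r i.
    by move: rpos; rewrite prodgen_rcons -mulmxA gen_sroot mulmxN.
  rewrite prodgen_rcons -r'E; apply: IH; first by rewrite rr' in rm; apply: ltnW.
  by rewrite r'E -prodgen_rcons.
have ip : i != p.
  apply/eqP=> ip; have := rneg p; rewrite coordN -ip_hroot -rh ip_prodgen.
  by rewrite ipC ip_sroot_hroot ip eqxx.
have [//||s [sp rs]] := IH r.
  by move: rh; rewrite prodgen_rcons -mulmxA gen_hroot.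
by exists (rcons s i); rewrite all_rcons ip sp !prodgen_rcons rs.
Qed.

(* [v |-> hroot - v] reverses the order on the roots with [p]-coordinate 1. *)
Lemma root_ascent v : is_root v -> v p 0 = 1 ->
  exists s, [/\ all (fun i => i != p) s, v = prodgen s *m (gen p *m hroot)
              & height v = height hroot - (size s)%:Z - 1].
Proof.
move=> rv vp; have [||s [sp vE hs]] := @root_descent n Hn p (hroot - v).
- by rewrite /is_root !ipE (ipC v) rv !ip_hroot hroot_p vp.
- by rewrite coordD coordN hroot_p vp.
exists s; split=> //; last by move: hs; rewrite heightB; lia.
by rewrite genp_hroot mulmxBr prodgen_hroot // -vE opprB addrC subrK.
Qed.

End HighestRoot.

(** * Buildings of type E_n *)

Section Building.
Variables (n : nat) (Hn : En n).
Variables (C : Type) (delta : C -> C -> 'M[int]_n) (Hb : is_thick_building delta).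
Implicit Types (i j k : 'I_n) (u v : 'cV[int]_n) (r s a : seq 'I_n) (c d x y z : C).

Lemma deltaW c d : exists s, delta c d = prodgen s.
Proof. by case: Hb => dW _ _ _ _; apply: dW. Qed.

Lemma delta_eq1 c d : delta c d = 1%:M -> c = d.
Proof. by case: Hb => _ d1 _ _ _ /d1. Qed.

Lemma deltaxx c : delta c c = 1%:M.
Proof. by case: Hb => _ d1 _ _ _; apply/d1. Qed.

Lemma delta_step c c' d i : delta c' c = gen i ->
  delta c' d = gen i *m delta c d \/ delta c' d = delta c d.
Proof. by case: Hb => _ _ st _ _ /(st _ d)[]. Qed.

Lemma delta_exists c d i :
  exists c', delta c' c = gen i /\ delta c' d = gen i *m delta c d.
Proof. by case: Hb => _ _ _ ex _; apply: ex. Qed.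

Lemma adj_sym c d i : delta c d = gen i -> delta d c = gen i.
Proof.
move=> cd; have [c' [c'c]] := delta_exists c d i.
by rewrite cd gen_gen => /delta_eq1 <-.
Qed.

(** The axioms move only the first argument. Walk from [c] to [d] along a reduced word: the distance
    back to [c] gains a letter at every step, since otherwise exchange would shorten the word. *)
Lemma delta_rev c d s : delta c d = prodgen s -> delta d c = prodgen (rev s).
Proof.
move=> cds; have [m [[t [tm cdt]] min_t]] := len_is_exists (ex_intro _ s cds).
rewrite -(@prodgen_rev_eq _ t s) -?cdt //.
suff gal b a x : t = a ++ b -> delta x d = prodgen b -> delta x c = prodgen (rev a) ->
    delta d c = prodgen (rev t) by apply: (gal t [::] c); rewrite ?deltaxx.
elim: b a x => [|j b IH] a x tab xd xc.
  by rewrite -(delta_eq1 xd) xc tab cats0.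
have [x' [x'x x'd]] := delta_exists x d j.
apply: (IH (rcons a j) x'); first by rewrite cat_rcons.
  by rewrite x'd xd /= mulmxA gen_gen mul1mx.
rewrite rev_rcons /= -xc; case: Hb => _ _ st _ _.
have [_] := st _ c _ _ x'x; apply=> l; rewrite xc; apply: (len_gen_up Hn).
rewrite revK; have aj : is_root (prodgen a *m sroot j) by apply/root_prodgen/root_sroot.
have [//|/(exchange Hn)[a' [aa' a'E]]] := root_sign Hn aj.
have : (m <= size (a' ++ b))%N.
  by apply: min_t; rewrite cdt tab !prodgen_cat a'E /= mulmxA.
by rewrite -tm tab !size_cat aa' /=; lia.
Qed.

Lemma deltaV c d : delta d c *m delta c d = 1%:M.
Proof. by have [s cd] := deltaW c d; rewrite (delta_rev cd) cd prodgen_revK. Qed.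

Lemma delta_unique c d (X : 'M[int]_n) : delta d c *m X = 1%:M -> delta c d = X.
Proof. by move=> dcX; rewrite -[LHS]mulmx1 -dcX mulmxA deltaV mul1mx. Qed.

Lemma ip_delta_adj c d u v : ip (delta c d *m u) v = ip u (delta d c *m v).
Proof. by have [s cd] := deltaW c d; rewrite (delta_rev cd) cd ip_prodgen_adj. Qed.

Lemma root_delta c d v : is_root v -> is_root (delta c d *m v).
Proof. by have [s ->] := deltaW c d; apply: root_prodgen. Qed.

Lemma delta_up c c' d i : delta c' c = gen i -> nonneg (delta d c *m sroot i) ->
  delta c' d = gen i *m delta c d.
Proof.
move=> c'c dci; have [s cd] := deltaW c d; case: Hb => _ _ st _ _.
have [_] := st _ d _ _ c'c; apply=> m; rewrite cd; apply: (len_gen_up Hn).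
by rewrite -(delta_rev cd).
Qed.

Lemma delta_mulr c d d' i : delta d' c = gen i *m delta d c -> delta c d' = delta c d *m gen i.
Proof.
move=> d'c; apply: delta_unique.
by rewrite d'c -mulmxA (mulmxA (delta d c)) deltaV mul1mx gen_gen.
Qed.

Lemma delta_upr c d d' i : delta d' d = gen i -> nonneg (delta c d *m sroot i) ->
  delta c d' = delta c d *m gen i.
Proof. by move=> d'd /(delta_up d'd); apply: delta_mulr. Qed.

Lemma delta_stepr c d d' i : delta d' d = gen i ->
  delta c d' = delta c d *m gen i \/ delta c d' = delta c d.
Proof.
case/(delta_step c) => [/delta_mulr|d'c]; first by left.
by right; apply: delta_unique; rewrite d'c deltaV.
Qed.

Lemma panel_adj c x y i : delta x c = gen i -> delta y c = gen i -> x <> y ->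
  delta x y = gen i.
Proof.
move=> xc /adj_sym cy xy; have [xyE|->//] := delta_step y xc.
by case: xy; apply: delta_eq1; rewrite xyE cy gen_gen.
Qed.

Lemma gallery_ind (P : C -> Prop) :
  (forall c c' i, delta c' c = gen i -> P c -> P c') -> forall c d, P c -> P d.
Proof.
move=> Pstep c d; have [s] := deltaW c d.
elim: s c => [|i s IH] c cd Pc; first by rewrite -(delta_eq1 cd).
have [c' [c'c c'd]] := delta_exists c d i.
apply: (IH c'); last exact: Pstep c'c Pc.
by rewrite c'd cd /= mulmxA gen_gen mul1mx.
Qed.

(** The hypothesis on signs says that $s_i$ shortens the distance to [d]. If $x\ne y$, they are
    $i$-adjacent, and going from [y] to [x] lengthens the distance, which therefore cannot be the
    same for both. *)
Lemma proj_unique c d x y i : delta x c = gen i -> delta y c = gen i ->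
  delta x d = gen i *m delta c d -> delta y d = gen i *m delta c d ->
  nonneg (- (delta d c *m sroot i)) -> x = y.
Proof.
move=> xc yc xd yd dci; apply: NNPP => xy.
have xyi := panel_adj xc yc xy.
have dy : delta d y = delta d c *m gen i.
  by apply: delta_unique; rewrite yd -mulmxA (mulmxA (delta c d)) deltaV mul1mx gen_gen.
have xd' : delta x d = gen i *m delta y d.
  by apply: (delta_up xyi); rewrite dy -mulmxA gen_sroot mulmxN.
have g1 : gen i = 1%:M.
  have := congr1 (fun A => A *m delta d c) xd'.
  rewrite xd yd -!mulmxA deltaV mulmx1 => ->; exact: gen_gen.
have := @gen_sroot n i; rewrite g1 mul1mx => /matrixP/(_ i 0).
by rewrite coordN coord_sroot eqxx.
Qed.

End Building.

(** * Mutual positions of points *)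

Section PointPositions.
Variables (n : nat) (Hn : En n) (p : 'I_n) (Hp : nat_of_ord p = point_type n).
Variables (C : Type) (delta : C -> C -> 'M[int]_n) (Hb : is_thick_building delta).
Implicit Types (i j k : 'I_n) (u v : 'cV[int]_n) (r s a : seq 'I_n) (c d x y z : C).

Local Notation hr := (hroot n).

Definition ppos c d : int := (delta c d *m hr) p 0.

Lemma ppos_ip c d : ppos c d = ip hr (delta c d *m hr).
Proof. by rewrite (ip_hroot Hn Hp). Qed.

Lemma pposC c d : ppos c d = ppos d c.
Proof. by rewrite !ppos_ip ipC (ip_delta_adj Hn Hb). Qed.

Lemma pposxx c : ppos c c = 2.
Proof. by rewrite /ppos (deltaxx Hb) mul1mx (hroot_p Hn Hp). Qed.

Lemma same_pointP c d : same_point delta c d <->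
  exists s, all (fun i => i != p) s /\ delta c d = prodgen s.
Proof.
have E s : all (fun i => i != p) s = all (fun i => nat_of_ord i != point_type n) s.
  by apply: eq_all => i; rewrite -Hp.
by split=> -[s [sp cd]]; exists s; rewrite ?E // -E.
Qed.

Lemma ppos_step c c' d i : i != p -> delta c' c = gen i -> ppos c' d = ppos c d.
Proof.
by move=> ip /(delta_step Hb d)[] c'd; rewrite /ppos c'd // -mulmxA gen_coord // eq_sym.
Qed.

Lemma ppos_same_point c c' d : same_point delta c c' -> ppos c' d = ppos c d.
Proof.
case/same_pointP=> s []; elim: s c => [|i s IH] c /=; first by move=> _ /(delta_eq1 Hb) ->.
case/andP=> ip sp cc'; have [c1 [c1c c1c']] := delta_exists Hb c c' i.
rewrite -(ppos_step d ip c1c); apply: (IH c1 sp).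
by rewrite c1c' cc' mulmxA gen_gen mul1mx.
Qed.

(** The value 2 forces $wh=h$, and the stabilizer of $h$ is the parabolic subgroup without $s_p$. *)
Lemma same_point_ppos c d : same_point delta c d <-> ppos c d = 2.
Proof.
split=> [/(ppos_same_point d) <-|cd]; first exact: pposxx.
apply/same_pointP; have [r rE] := (deltaW Hb) c d; rewrite rE.
apply: (stab_hroot Hn Hp); rewrite -rE; apply/esym/(root_eq Hn).
- exact: (root_hroot Hn Hp).
- exact/(root_delta Hb)/(root_hroot Hn Hp).
- by rewrite -ppos_ip cd.
Qed.

Lemma same_point_gallery a c d : all (fun i => i != p) a ->
  exists c', same_point delta c c' /\ delta c' d = prodgen (rev a) *m delta c d.
Proof.
elim: a c => [|i a IH] c /=.
  by exists c; rewrite mul1mx; split=> //; apply/same_point_ppos/pposxx.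
case/andP=> ip ap; have [c1 [c1c c1d]] := delta_exists Hb c d i.
have [c' [c1c' c'd]] := IH c1 ap; exists c'; split.
  by apply/same_point_ppos; rewrite -(ppos_step c' ip c1c); apply/same_point_ppos.
by rewrite c'd c1d rev_cons prodgen_rcons mulmxA.
Qed.

Lemma ppos_adj c d : delta c d = gen p -> ppos c d = 1.
Proof.
move=> cd; rewrite /ppos cd (genp_hroot Hn Hp) coordD coordN (hroot_p Hn Hp).
by rewrite coord_sroot eqxx.
Qed.

Lemma collinear_ppos c d : collinear delta c d <-> ppos c d = 1.
Proof.
split=> [[_ [c' [d' [i [cc' [dd' [iE c'd']]]]]]]|cd1].
  have ip : i = p by apply: val_inj; rewrite /= iE Hp.
  rewrite -(ppos_same_point d cc') pposC -(ppos_same_point c' dd') pposC.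
  by apply: ppos_adj; rewrite c'd' ip.
split; first by move/same_point_ppos; rewrite cd1.
have rcd : is_root (delta c d *m hr) by exact/(root_delta Hb)/(root_hroot Hn Hp).
(* Walking along [a] inside the point of [c] and then across a [p]-panel leads to the point of
   [d]. *)
have [a [ap aE _]] := root_ascent Hn Hp rcd cd1.
have [c' [cc' c'd]] := same_point_gallery c d ap.
have [z [zc' zd]] := delta_exists Hb c' d p.
exists c', z, p; split=> //; split; last by split=> //; apply: (adj_sym Hb).
apply/same_point_ppos; rewrite pposC /ppos zd c'd -!mulmxA aE.
by rewrite (mulmxA (prodgen (rev a))) prodgen_revK mul1mx mulmxA gen_gen mul1mx (hroot_p Hn Hp).
Qed.

(** A single [p]-step has to raise the value from $-1$ to $1$, which forces
    $\langle\alpha_p,wh\rangle=-2$, where $w=\delta(c,d)$. *)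
Lemma common_neighbour_last c d z : ppos c d = -1 -> ppos z d = 1 ->
  delta c z *m hr = gen p *m hr ->
  - (delta c d *m hr) = sroot p /\
  exists z1, [/\ delta z1 c = gen p, delta z1 d = gen p *m delta c d & same_point delta z1 z].
Proof.
move=> cd zd cz; have [z1 [z1c z1z]] := delta_exists Hb c z p.
have z1_z : same_point delta z1 z.
  by apply/same_point_ppos; rewrite /ppos z1z -mulmxA cz mulmxA gen_gen mul1mx (hroot_p Hn Hp).
have z1d1 : ppos z1 d = 1 by rewrite -(ppos_same_point d z1_z).
have z1d : delta z1 d = gen p *m delta c d.
  have [//|z1d] := delta_step Hb d z1c.
  by move: z1d1; rewrite /ppos z1d -/(ppos c d) cd.
split; last by exists z1.
apply: (root_eq Hn); [exact/is_rootN/(root_delta Hb)/(root_hroot Hn Hp)|exact: root_sroot|].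
move: z1d1; rewrite /ppos z1d -mulmxA gen_act !coordE eqxx mulr1 -/(ppos c d) cd.
by rewrite ipNl ipC; lia.
Qed.

(* From [c], a gallery of type [a], followed by [p], leads to the point of [z]. Along it the
   height of [- delta _ d hr] drops by at most 1 at each step of [a], and has to reach 1. If
   every step is needed, all these galleries are made of projections of [d], hence coincide. *)
Lemma common_neighbour_walk d a : all (fun i => i != p) a -> forall c z,
  ppos c d = -1 -> ppos z d = 1 -> delta c z *m hr = prodgen a *m (gen p *m hr) ->
  height (- (delta c d *m hr)) <= (size a)%:Z + 1 /\
  (height (- (delta c d *m hr)) = (size a)%:Z + 1 -> forall z', ppos z' d = 1 ->
     delta c z' *m hr = prodgen a *m (gen p *m hr) -> same_point delta z z').
Proof.
elim: a => [_ c z cd zd|j a IH /=].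
  rewrite /= mul1mx => cz; have [cdp [z1 [z1c z1d z1z]]] := common_neighbour_last cd zd cz.
  split; first by rewrite cdp height_sroot.
  move=> _ z' z'd cz'; have [_ [z2 [z2c z2d z2z']]] := common_neighbour_last cd z'd cz'.
  have z12 : z1 = z2.
    apply: (proj_unique Hn Hb z1c z2c z1d z2d); rewrite -cdp mulmxN mulmxA.
    rewrite (deltaV Hn Hb) mul1mx opprK.
    by apply: (@root_pos_coord _ Hn _ p); rewrite ?(hroot_p Hn Hp) //; apply: (root_hroot Hn Hp).
  apply/same_point_ppos; rewrite (ppos_same_point z' z1z) z12.
  exact/same_point_ppos.
case/andP=> jp /IH {}IH c z cd zd cz.
have vroot : is_root (- (delta c d *m hr)) by exact/is_rootN/(root_delta Hb)/(root_hroot Hn Hp).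
have vp : (- (delta c d *m hr)) p 0 = 1 by rewrite coordN -/(ppos c d) cd.
have jv1 := ip_sroot_le1 Hn vroot vp jp.
have first_step z' : ppos z' d = 1 -> delta c z' *m hr = gen j *m prodgen a *m (gen p *m hr) ->
    exists c1, [/\ delta c1 c = gen j, ppos c1 d = -1,
                   delta c1 z' *m hr = prodgen a *m (gen p *m hr) &
                   delta c1 d = gen j *m delta c d \/ delta c1 d = delta c d].
  move=> z'd cz'; have [c1 [c1c c1z']] := delta_exists Hb c z' j.
  exists c1; split=> //; first by rewrite (ppos_step d jp c1c).
    by rewrite c1z' -mulmxA cz' !mulmxA gen_gen mul1mx.
  exact: (delta_step Hb).
have [c1 [c1c c1d c1z c1dE]] := first_step z zd cz.
have [hc1 uniq_c1] := IH c1 z c1d zd c1z.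
have hg := height_gen j (- (delta c d *m hr)).
rewrite mulmxN in hg.
split; first by case: c1dE hc1 => ->; rewrite -?mulmxA ?hg; lia.
move=> hc z' z'd cz'; have [c2 [c2c c2d c2z' c2dE]] := first_step z' z'd cz'.
have [hc2 _] := IH c2 z' c2d z'd c2z'.
(* A step leaving the distance to [d] unchanged would keep the height at [size a + 2], above the
   bound for the remaining word. *)
have down c' : delta c' d = gen j *m delta c d \/ delta c' d = delta c d ->
    height (- (delta c' d *m hr)) <= (size a)%:Z + 1 -> delta c' d = gen j *m delta c d.
  by case=> // -> hle; exfalso; move: hle; rewrite hc; lia.
have {}c1dE := down _ c1dE hc1; have {}c2dE := down _ c2dE hc2.
have jv : ip (sroot j) (- (delta c d *m hr)) = 1.
  by move: hc1; rewrite c1dE -mulmxA hg hc; lia.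
have c12 : c1 = c2.
  apply: (proj_unique Hn Hb c1c c2c c1dE c2dE); apply: (@root_neg_coord _ Hn _ p).
    exact/(root_delta Hb)/root_sroot.
  by rewrite -(ip_hroot Hn Hp) -(ip_delta_adj Hn Hb) ipC; move: jv; rewrite ipNr; lia.
apply: uniq_c1 => //; last by rewrite c12.
by rewrite c1dE -mulmxA hg hc jv; lia.
Qed.

(** Here $-\delta(c,d)h=s_ph$ is only 1 below $h$ in height. This makes every walk to a common
    neighbour as long as possible, which is the equality case, where the neighbour is unique. *)
Lemma position2'_gen_w0 c d : delta c d = gen p *m - Psigma n -> position2' delta c d.
Proof.
move=> cdE.
have cdhr : - (delta c d *m hr) = gen p *m hr.
  by rewrite cdE -mulmxA mulNmx (Psigma_hroot Hn Hp) mulmxN opprK.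
have cd : ppos c d = -1.
  have := congr1 (fun v : 'cV_n => v p 0) cdhr; rewrite /= coordN -/(ppos c d) (genp_hroot Hn Hp).
  by rewrite coordD coordN (hroot_p Hn Hp) coord_sroot eqxx; lia.
have hcd : height (- (delta c d *m hr)) = height hr - 1.
  by rewrite cdhr (genp_hroot Hn Hp) heightB height_sroot.
have [a [ap aE ha]] : exists a, [/\ all (fun i => i != p) a,
    sroot p = prodgen a *m (gen p *m hr) & height (sroot p) = height hr - (size a)%:Z - 1].
  by apply: (root_ascent Hn Hp); [exact: root_sroot | rewrite coord_sroot eqxx].
rewrite height_sroot in ha.
(* The walk bound gives [b] at least [height hr - 2] letters, so the root has height at most 1 and
   its descent is empty. *)
have neighbour z : ppos c z = 1 -> ppos z d = 1 -> delta c z *m hr = sroot p.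
  move=> cz zd; have rz : is_root (delta c z *m hr) by exact/(root_delta Hb)/(root_hroot Hn Hp).
  have [b [bp bE hb]] := root_ascent Hn Hp rz cz.
  have [hle _] := common_neighbour_walk bp cd zd bE.
  have [[|? s] [_ sE hs]] := root_descent Hn rz cz; first by rewrite sE mul1mx.
  by move: hs hle; rewrite hcd hb /=; lia.
split; first by move/same_point_ppos; rewrite cd.
split; first by move/collinear_ppos; rewrite cd.
(* Existence: the word [a] moves [c] inside its point until $\delta(c',d)h=-\alpha_p$, and a
   [p]-step turns this into $\alpha_p$. *)
have [|c' [cc' c'd]] := @same_point_gallery (rev a) c d; first by rewrite all_rev.
have [z [zc' zd]] := delta_exists Hb c' d p.
have c'dhr : delta c' d *m hr = - sroot p.
  by rewrite c'd revK -mulmxA -[delta c d *m hr]opprK cdhr mulmxN -aE.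
have cz1 : ppos c z = 1.
  by rewrite -(ppos_same_point z cc'); apply/ppos_adj/(adj_sym Hb).
have zd1 : ppos z d = 1.
  by rewrite /ppos zd -mulmxA c'dhr mulmxN gen_sroot opprK coord_sroot eqxx.
exists z; split; [|split]; [exact/collinear_ppos|exact/collinear_ppos|].
move=> z' /collinear_ppos cz' /collinear_ppos z'd.
have czE : delta c z *m hr = prodgen a *m (gen p *m hr) by rewrite neighbour.
have [_] := common_neighbour_walk ap cd zd1 czE; apply=> //.
  by rewrite hcd; lia.
by rewrite neighbour.
Qed.

End PointPositions.

(** * Kangaroos *)

(** The diagram is connected: every node leads to the branch node, of index 3, and this one to
    [p]. *)
Lemma diagram_ind n (Hn : En n) (p : 'I_n) (Hp : nat_of_ord p = point_type n)
    (Q : 'I_n -> Prop) :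
  (forall i j, cartan n i j = -1 -> Q i -> Q j) -> forall i, Q i -> Q p.
Proof.
move=> Qstep i Qi; pose Qn a := exists2 j : 'I_n, nat_of_ord j = a & Q j.
suff [j jE Qj] : Qn (point_type n) by have -> : p = j by apply: val_inj; rewrite /= jE.
have step a b : (b < n)%N -> En_edge a b || En_edge b a -> Qn a -> Qn b.
  move=> bn ab [j ja Qj]; exists (Ordinal bn) => //; apply: Qstep Qj.
  rewrite mxE /= ja ab; case: eqP => // jb; move: ab.
  by rewrite -ja jb /=; case: (b) => [|[|[|[|[|[|[|]]]]]]].
have {Qi}: Qn i by exists i.
have := ltn_ord i; move: (nat_of_ord i) => a; rewrite /point_type.
have [n3 [n0 [n2 ]]] : (3 < n)%N /\ (0 < n)%N /\ (2 < n)%N /\ (1 < n)%N /\ (4 < n)%N /\ (5 < n)%N.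
  by case: Hn => [->|[->|->]].
case=> n1 [n4 n5] an Qa; have {Qa an}: Qn 3%N.
  case: a Qa an => [|[|[|[|[|[|[|[|a]]]]]]]] Qa an //.
  - by apply: (step 2%N) => //; apply: (step 0%N).
  - exact: (step 1%N).
  - exact: (step 2%N).
  - exact: (step 4%N).
  - by apply: (step 4%N) => //; apply: (step 5%N).
  - by apply: (step 4%N) => //; apply: (step 5%N) => //; apply: (step 6%N).
  - apply: (step 4%N) => //; apply: (step 5%N) => //; apply: (step 6%N) => //.
    by apply: (step 7%N) => //; apply: ltnW.
  - by exfalso; move: an; case: Hn => [->|[->|->]].
case: (Hn) => [nE|[nE|nE]]; rewrite nE /= => Q3.
- by apply: (step 3%N).
- by apply: (step 2%N) => //; apply: (step 3%N).
- apply: (step 6%N) => //; first by rewrite nE.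
  apply: (step 5%N) => //; first by rewrite nE.
  by apply: (step 4%N) => //; apply: (step 3%N).
Qed.

(** * Displacements next to the longest element *)

Section Kangaroo.
Variables (n : nat) (Hn : En n) (p : 'I_n) (Hp : nat_of_ord p = point_type n).
Variables (C : Type) (delta : C -> C -> 'M[int]_n) (Hb : is_thick_building delta).
Variables (theta : C -> C) (Hop : oppomorphism delta theta).
Hypothesis Hk : polar_kangaroo delta theta.
Implicit Types (i j k : 'I_n) (u v : 'cV[int]_n) (c d x y z : C).

Local Notation w0 := (- Psigma n).

Lemma w0_sroot i : w0 *m sroot i = - sroot (sg Hn i).
Proof. by rewrite mulNmx Psigma_sroot. Qed.

Lemma w0K : w0 *m w0 = 1%:M.
Proof. by rewrite mulNmx mulmxN opprK PsigmaK. Qed.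

Lemma w0_gen i : w0 *m gen (sg Hn i) = gen i *m w0.
Proof. by rewrite mulNmx mulmxN Psigma_gen // sgK. Qed.

Lemma theta_adj c c' i : delta c' c = gen i -> delta (theta c') (theta c) = gen (sg Hn i).
Proof. by case: Hop => _ dth c'c; rewrite dth c'c (opp_twist_gen Hn). Qed.

(* In the residue of type [{i, j}] of [c], opposite its image, [theta] followed by the
   projection is a duality of a projective plane, and the hypothesis provides an absolute point
   or an absolute line. A duality with an absolute element has both kinds of them, and
   incident point-line pairs in which precisely one given element is absolute. *)
Lemma gen_w0_edge i j c : cartan n i j = -1 -> delta c (theta c) = gen i *m w0 ->
  exists c', delta c' (theta c') = gen j *m w0.
Proof.
move=> ij cE; have ji : cartan n j i = -1 by rewrite cartanC.
have [c1 [c1c c1c']] := delta_exists Hb c (theta c) j.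
have [c2 [c2c1 c2E]] : exists c2, delta c2 c1 = gen i /\
    delta c2 (theta c1) = gen j *m (gen i *m w0).
  case: (delta_stepr Hn Hb c1 (theta_adj c1c)) => c1E; rewrite c1c' cE in c1E.
    have [c2 [c2c1 c2E]] := delta_exists Hb c1 (theta c1) i; exists c2; split=> //.
    have c1E' : delta c1 (theta c1) = gen i *m gen j *m gen i *m w0.
      by rewrite c1E braid // -!mulmxA w0_gen.
    by rewrite c2E c1E' !mulmxA gen_gen mul1mx.
  (* Now [c1] has displacement $s_js_iw_0$. At most one chamber of its $i$-panel is nearer to
     [theta c1], so one of two further chambers keeps this distance. *)
  case: (Hb) => _ _ _ _ thick; have [d1 [d2 [d12 []]]] := thick c1 i.
  move=> /(adj_sym Hb) d1c /(adj_sym Hb) d2c.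
  have [d1E|d1E] := delta_step Hb (theta c1) d1c; last by exists d1; rewrite d1E c1E.
  have [d2E|d2E] := delta_step Hb (theta c1) d2c; last by exists d2; rewrite d2E c1E.
  exists d1; split=> //.
  have -> : delta d1 (theta c1) = gen i *m delta d2 (theta c1).
    apply: (delta_up Hn Hb (panel_adj Hb d1c d2c d12)).
    have -> : delta (theta c1) d2 = w0 *m gen i *m gen j *m gen i.
      apply: (delta_unique Hn Hb); rewrite d2E c1E -!mulmxA.
      rewrite (mulmxA w0 w0) w0K mul1mx (mulmxA (gen i) (gen i)) gen_gen mul1mx.
      by rewrite (mulmxA (gen j) (gen j)) gen_gen mul1mx gen_gen.
    rewrite -!mulmxA gen_sroot mulmxN gen_sroot_edge // mulmxN mulmxDr gen_sroot.
    rewrite gen_sroot_edge // [_ + _ - _]addrC addKr.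
    by rewrite mulmxN w0_sroot opprK; apply: sroot_ge0.
  by rewrite d2E c1E mulmxA gen_gen mul1mx.
(* Passing from [theta c1] to [theta c2] lengthens the distance, as $s_js_iw_0$ sends
   $\alpha_{\sigma(i)}$ to $\alpha_i+\alpha_j$; the new factor cancels $s_i$. *)
exists c2; rewrite (delta_upr Hn Hb (theta_adj c2c1)) c2E.
  by rewrite -!mulmxA w0_gen !mulmxA -(mulmxA (gen j)) gen_gen mulmx1.
rewrite -!mulmxA w0_sroot sgK !mulmxN gen_sroot mulmxN opprK gen_sroot_edge //.
by move=> k; rewrite coordD addr_ge0 // sroot_ge0.
Qed.

Lemma no_gen_w0 i c : delta c (theta c) <> gen i *m w0.
Proof.
move=> cE; pose Q j := exists d, delta d (theta d) = gen j *m w0.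
have Qstep j k : cartan n j k = -1 -> Q j -> Q k.
  by move=> jk [d]; apply: gen_w0_edge.
have [c' c'E] := diagram_ind Hn Hp Qstep (ex_intro _ c cE : Q i).
by case: (Hk c') => _; apply; apply: (position2'_gen_w0 Hn Hp Hb).
Qed.

Lemma anisotropic_or_domestic : anisotropic delta theta \/ domestic delta theta.
Proof.
have [[c0 c0_opp]|nopp] := classic (exists c, opposite delta c (theta c)); last first.
  by right=> c c_opp; apply: nopp; exists c.
left; have c0E : delta c0 (theta c0) = w0.
  case: c0_opp => m [len_m max_m]; apply: (longest_eq Hn _ len_m) => //.
  by case: Hb => dW _ _ _ _; apply: dW.
suff w0E c : delta c (theta c) = w0 by move=> c; rewrite /opposite w0E -c0E.
apply: (gallery_ind Hb (P := fun c => delta c (theta c) = w0)) c0E => d d' i d'd dE.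
(* Moving [d] and [theta d] may each contribute a factor. Both cancel across $w_0$; exactly one
   gives the excluded $s_iw_0$. *)
case: (delta_stepr Hn Hb d' (theta_adj d'd)) => d'E;
  case: (delta_step Hb (theta d) d'd) => d'dE; rewrite d'dE dE in d'E => //.
- by rewrite d'E -mulmxA w0_gen mulmxA gen_gen mul1mx.
- by case: (@no_gen_w0 i d'); rewrite d'E w0_gen.
- by case: (@no_gen_w0 i d').
Qed.

Definition is_reflection (w : 'M[int]_n) (b : 'cV[int]_n) : Prop :=
  forall v, w *m v = v - ip b v *: b.

Lemma no_reflection_coord1 c b : is_reflection (delta c (theta c)) b -> b p 0 <> 1.
Proof.
move=> cb bp; case: (Hk c) => + _; apply; apply/(collinear_ppos Hn Hp Hb).
by rewrite /ppos cb coordD coordN coordZ hroot_p // ipC (ip_hroot Hn Hp) bp.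
Qed.

(** * Fixed chambers in the type-preserving case *)

Section TypePreserving.
Hypothesis sg_id : forall i, sg Hn i = i.

(** A $j$-step yields $s_js_b$. Its image step lengthens, since $s_js_b\alpha_j=b$ is positive, and
    yields $s_js_bs_j$. *)
Lemma reflection_up c b j : is_reflection (delta c (theta c)) b -> nonneg b ->
  ip (sroot j) b = -1 -> exists c', is_reflection (delta c' (theta c')) (gen j *m b).
Proof.
move=> cb b0 jb; have [c' [c'c c'E]] := delta_exists Hb c (theta c) j.
have adj := theta_adj c'c; rewrite sg_id in adj.
exists c' => v; rewrite (delta_upr Hn Hb adj) c'E.
  rewrite -!mulmxA cb mulmxBr -scalemxAr mulmxA gen_gen mul1mx.
  by rewrite -ip_gen_adj.
rewrite -mulmxA cb ipC jb scaleN1r opprK mulmxDr gen_sroot gen_act jb scaleN1r opprK.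
by rewrite addrC addrK.
Qed.

Lemma no_fixed_reflection c i : delta c (theta c) <> gen i.
Proof.
move=> cE; have c_refl : is_reflection (delta c (theta c)) (sroot i).
  by move=> v; rewrite cE gen_act.
(* The support of [b] contains [j] but not [p], so [Q p] is absurd; it suffices to spread [Q] along
   the diagram. *)
pose Q j := exists b c, [/\ is_root b, nonneg b, is_reflection (delta c (theta c)) b,
  0 < b j 0 & b p 0 = 0].
have [pi|pi] := eqVneq p i.
  by apply: (no_reflection_coord1 c_refl); rewrite pi coord_sroot eqxx.
have Qstep j k : cartan n j k = -1 -> Q j -> Q k.
  move=> jk [b [d [rb b0 db bj bp]]].
  have [bk|bk] := ltrP 0 (b k 0); first by exists b, d.
  have {}bk : b k 0 = 0 by have := b0 k; lia.
  (* At least $-1$ because $b\ne-\alpha_k$; negative because the neighbour [j] lies in the support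
     and [k] does not. *)
  have kb : ip (sroot k) b = -1.
    have : -1 <= ip (sroot k) b.
      rewrite -[leRHS]opprK lerN2 -ipNr; apply: (root_ip_le1 Hn) => //.
      - exact: root_sroot.
      - exact: is_rootN.
      - move=> kb; have := congr1 (fun v : 'cV_n => v k 0) kb.
        by rewrite /= coord_sroot eqxx coordN bk.
    suff : ip (sroot k) b < 0 by lia.
    rewrite ip_sumr (bigD1 j) //= ip_sroots cartanC jk.
    rewrite mulrN1 ltr_nwDl ?oppr_lt0 //.
    apply: sumr_le0 => l lj; have [->|lk] := eqVneq l k; first by rewrite bk mul0r.
    rewrite ip_sroots mxE eq_sym (negPf lk).
    by have := b0 l; case: ifP => _; lia.
  have [d' d'b] := reflection_up db b0 kb.
  have gbk : (gen k *m b) k 0 = 1.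
    by rewrite gen_act kb scaleN1r opprK coordD bk coord_sroot eqxx.
  have [pk|pk] := eqVneq p k.
    by case: (no_reflection_coord1 d'b); rewrite {1}pk.
  have rgb : is_root (gen k *m b) by apply: root_gen.
  exists (gen k *m b), d'; split=> //; last by rewrite gen_coord.
  - by apply: (@root_pos_coord _ Hn _ k); rewrite ?gbk.
  - by rewrite gbk.
have Qi : Q i.
  exists (sroot i), c; split=> //; first exact: root_sroot.
  - exact: sroot_ge0.
  - by rewrite coord_sroot eqxx.
  - by rewrite coord_sroot (negPf pi).
by have [b [d [_ _ _ bp bp0]]] := diagram_ind Hn Hp Qstep Qi; rewrite bp0 in bp.
Qed.

(** A chamber $i$-adjacent to a fixed one has displacement $1$ or $s_i$, and $s_i$ is excluded. *)
Lemma fixed_chamber c d : theta c = c -> theta d = d.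
Proof.
apply: (gallery_ind Hb (P := fun c => theta c = c)) => x y i yx xx.
have adj := theta_adj yx; rewrite sg_id in adj.
have yx' : delta y (theta x) = gen i by rewrite xx.
case: (delta_stepr Hn Hb y adj) => yE; rewrite yx' in yE.
  by apply/esym/(delta_eq1 Hb); rewrite yE gen_gen.
by case: (no_fixed_reflection yE).
Qed.

End TypePreserving.
End Kangaroo.

Theorem theorem3p2 (n : nat) (Hn : n = 6%N \/ n = 7%N \/ n = 8%N)
  (C : Type) (delta : C -> C -> 'M[int]_n) (Hb : is_thick_building delta)
  (theta : C -> C) (Hop : oppomorphism delta theta) (Hnt : exists c, theta c <> c)
  (Hk : polar_kangaroo delta theta) :
  (n = 6%N -> anisotropic delta theta \/ domestic delta theta) /\
  (n <> 6%N -> anisotropic delta theta \/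
                (domestic delta theta /\ forall c, theta c <> c)).
Proof.
have pn : (point_type n < n)%N by case: Hn => [->|[->|->]].
have main := anisotropic_or_domestic (p := Ordinal pn) Hn erefl Hb Hop Hk.
split=> // n6; case: main => [|dom]; [by left|right; split=> // c cc].
case: Hnt => d; apply; apply: (fixed_chamber (p := Ordinal pn) erefl Hb Hop Hk _ d cc).
by move=> i; apply: val_inj; rewrite /= /sigma_nat; case: eqP.
Qed.
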